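(* Let $\alpha > 0$ be a real number and let $m_1, m_2, m_3, m_4 > 0$ be masses. Let $q = (q_1,q_2,q_3,q_4) \in (\mathbb{R}^2)^4$ be a planar four-body central configuration for the potential $U_\alpha(q) = \sum_{i<j} m_i m_j \|q_i - q_j\|^{-\alpha}$ with these masses, and suppose that $q$ is convex. If the two diagonals of the quadrilateral formed by $q_1,q_2,q_3,q_4$ are perpendicular, then the configuration is a kite.
   Context: Here $q_i \in \mathbb{R}^2$ and $m_i$ are the position and mass of the $i$-th body, the positions $q_i$ are pairwise distinct, $r_{ij} = \|q_i - q_j\|$, $M = \sum_{i=1}^4 m_i$, and $c = \frac{1}{M}\sum_{i=1}^4 m_i q_i$ is the center of mass. The moment of inertia is $I(q) = \sum_{i=1}^4 m_i \|q_i - c\|^2 = \frac{1}{M}\sum_{i<j} m_i m_j r_{ij}^2$. Central configuration: $q=(q_1,\dots,q_4)\in\mathbb{R}^{8}$ is a planar central configuration if it is a critical point of $U_\alpha$ subject to the constraint $I = I_0$, where $I_0$ is some positive constant. Convex: a configuration of four bodies is convex if no body lies in (inside or on) the convex hull of the other three bodies. The four positions are then the vertices of a convex quadrilateral, whose diagonals are the two segments joining opposite vertices. Kite: a configuration of four bodies is a kite if there is a line (axis of symmetry) containing two of the bodies, such that the other two bodies are located symmetrically with respect to this line, i.e. they are interchanged by the reflection across it. (This is a condition on the positions only.) *)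

(* Defs.v *)
From HB Require Import structures.
From mathcomp Require Import all_boot all_order all_algebra.
From mathcomp Require Import all_classical all_reals all_analysis.
Set Implicit Arguments.
Unset Strict Implicit.
Unset Printing Implicit Defensive.
Import Order.TTheory GRing.Theory Num.Theory.
Import numFieldNormedType.Exports.
Local Open Scope classical_set_scope.
Local Open Scope ring_scope.

Section Plane.
Variable R : realType.
Implicit Types u v p : 'rV[R]_2.

Definition dotp u v : R := \sum_(j < 2) u 0 j * v 0 j.

(* The library norm of 'rV[R]_2 is the sup norm, hence this definition. *)
Definition enorm u : R := Num.sqrt (dotp u u).

Definition line p u : set 'rV[R]_2 := [set p + t *: u | t in [set: R]].

(* Orthogonal reflection across [line p u], for [u != 0]. *)
Definition reflection p u x : 'rV[R]_2 :=
  p + (2 * dotp (x - p) u / dotp u u) *: u - (x - p).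

Definition convex_hull (A : set 'rV[R]_2) : set 'rV[R]_2 :=
  smallest (@convex_set R 'rV[R]_2) A.

End Plane.

(* [x] is a critical point of the restriction of [f] to [S]: [f] is stationary
   at [x] along every curve in [S] that passes through [x] with a velocity. *)
Definition critical_point_on (R : realType) (V : normedModType R)
    (f : V -> R) (S : set V) (x : V) : Prop :=
  S x /\
  forall gamma : R -> V,
    gamma 0 = x -> derivable gamma 0 1 -> (\forall t \near 0, S (gamma t)) ->
    is_derive (0 : R) (1 : R) (f \o gamma) 0.

Section FourBodies.
Variable R : realType.

(* The position of the i-th body is [row i q]. *)
Definition configuration := 'M[R]_(4, 2).

Implicit Types (q : configuration) (m : 'I_4 -> R) (alpha : R).

Definition dist_bodies q (i j : 'I_4) : R := enorm (row i q - row j q).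

Definition noncollision q : Prop := injective (fun i : 'I_4 => row i q).

Definition potential alpha m q : R :=
  \sum_(i < 4) \sum_(j < 4 | (i < j)%N)
    m i * m j * dist_bodies q i j `^ (- alpha).

Definition total_mass m : R := \sum_(i < 4) m i.

Definition center_of_mass m q : 'rV[R]_2 :=
  (total_mass m)^-1 *: \sum_(i < 4) m i *: row i q.

Definition inertia m q : R :=
  \sum_(i < 4) m i * enorm (row i q - center_of_mass m q) ^+ 2.

Definition central_configuration alpha m q : Prop :=
  exists I0 : R, 0 < I0 /\
    critical_point_on (potential alpha m)
      [set p : configuration | noncollision p /\ inertia m p = I0] q.

Definition convex_configuration q : Prop :=
  forall i : 'I_4,
    ~ convex_hull [set row j q | j in [set j : 'I_4 | j != i]] (row i q).

(* Bodies [i] and [j] are joined by a side when the line through them supports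
   the convex hull of the configuration: [n] is an outward normal. *)
Definition joined_by_side q (i j : 'I_4) : Prop :=
  exists n : 'rV[R]_2,
    [/\ n != 0, dotp n (row j q - row i q) = 0
      & forall k : 'I_4, dotp n (row k q - row i q) <= 0].

(* Meaningful for convex configurations, where all bodies are vertices. *)
Definition opposite_vertices q (i j : 'I_4) : Prop :=
  i != j /\ ~ joined_by_side q i j.

(* The labels need not follow the cyclic order of the vertices, so the two
   diagonals [i j] and [k l] are quantified over. *)
Definition perpendicular_diagonals q : Prop :=
  exists i j k l : 'I_4,
    [/\ uniq [:: i; j; k; l], opposite_vertices q i j, opposite_vertices q k l
      & dotp (row j q - row i q) (row l q - row k q) = 0].

Definition kite q : Prop :=
  exists (p u : 'rV[R]_2) (i j k l : 'I_4),
    [/\ u != 0, uniq [:: i; j; k; l],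
        line p u (row i q) /\ line p u (row j q),
        reflection p u (row k q) = row l q
      & reflection p u (row l q) = row k q].

End FourBodies.

(* Main.v *)
Require Import Defs.
From HB Require Import structures.
From mathcomp Require Import all_boot all_order all_algebra.
From mathcomp Require Import all_classical all_reals all_analysis.
From mathcomp Require Import ring lra.
Set Implicit Arguments.
Unset Strict Implicit.
Unset Printing Implicit Defensive.
Import Order.TTheory GRing.Theory Num.Theory.
Import numFieldNormedType.Exports.
Local Open Scope ring_scope.

(* Cut the diagonals at their intersection, in ratios s : 1 - s and t : 1 - t.
   With g r = r^(-alpha/2-1) a function of the squared distance, Lagrange's
   equations projected on the two orthogonal diagonals give Dziobek's relations
     A C = B D = E' F',
   where A = g12 - l, B = g23 - l, C = g34 - l, D = g14 - l belong to the sides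
   and E' = l - g13, F' = l - g24 to the diagonals; these six numbers have the
   same sign, which must be positive because the squared sides sum to less than
   twice the squared diagonals (if they vanish the quadrilateral is a rhombus).
   Suppose that neither diagonal is bisected, with 12 the longest side and 34
   the shortest. The relations give
     A / D = (A + F') (B + E') / ((C + E') (D + F'))
           = (g12 - g24) (g23 - g13) / ((g34 - g13) (g14 - g24))
           < g12 g23 / (g14 g34).
   On the other hand A / D = B / C = (B - A) / (C - D); since the squared sides
   satisfy r12 + r34 = r23 + r14 and 1 / g is convex,
   1 / g12 - 1 / g23 >= 1 / g14 - 1 / g34, which is the opposite inequality
   A / D >= g12 g23 / (g14 g34). *)

(** * Inequalities for the squared sides and the force law *)

(** Both [a + x] and [a + y] are convex combinations of [a] and [a + x + y], with complementary
    weights. Adding the two convexity inequalities for the [k]-th power therefore gives weight 1 to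
    each endpoint. This is the convexity of [1 / g], as [g r] is the inverse of the [k]-th power of
    [r]. *)
Lemma powR_convex_gap (R : realType) (k a x y : R) :
  1 <= k -> 0 <= a -> 0 < x -> 0 < y ->
  (a + x) `^ k + (a + y) `^ k <= a `^ k + (a + x + y) `^ k.
Proof.
move=> k1 a0 x0 y0.
have axy0 : 0 <= a + x + y by lra.
have convex (s t : R) : 0 < s -> 0 < t -> a + s + t = a + x + y ->
    (a + s) `^ k <= t / (s + t) * a `^ k + s / (s + t) * (a + x + y) `^ k.
  move=> s0 t0 st.
  have st0 : s + t != 0 by lra.
  have h0 : 0 <= t / (s + t) by apply: divr_ge0; lra.
  have h1 : t / (s + t) <= 1 by rewrite ler_pdivrMr; lra.
  have := @convex_powR R k k1 (Itv01 h0 h1) a (a + x + y).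
  rewrite !inE /= !in_itv /= !andbT => /(_ a0 axy0) conv_le.
  have {conv_le} : (t / (s + t) * a + (1 - t / (s + t)) * (a + x + y)) `^ k <=
    t / (s + t) * a `^ k + (1 - t / (s + t)) * (a + x + y) `^ k := conv_le.
  have -> : 1 - t / (s + t) = s / (s + t) by field.
  have -> : t / (s + t) * a + s / (s + t) * (a + x + y) = a + s.
    by rewrite -st; field.
  by [].
have hx := convex x y x0 y0 erefl.
have hy := convex y x y0 x0 ltac:(ring).
have xy0 : x + y != 0 by lra.
apply: le_trans (lerD hx hy) _; rewrite le_eqVlt; apply/orP; left; apply/eqP.
by field; rewrite [y + x]addrC xy0.
Qed.

(* [G] and [H] are the values of the force law on the two diagonals. *)
Lemma dziobek_no_gap (R : realType) (k s x y l G H : R) :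
  let g r := r `^ (- k) in
  1 <= k -> 0 < s -> 0 < x -> 0 < y -> 0 < G -> 0 < H -> G < l -> H < l ->
  l < g (s + x + y) ->
  (g (s + x + y) - l) * (g s - l) = (g (s + x) - l) * (g (s + y) - l) ->
  (g (s + x + y) - l) * (g s - l) = (l - G) * (l - H) -> False.
Proof.
move=> g k1 s0 x0 y0 G0 H0 Gl Hl.
have k0 : 0 < k by lra.
have incr u v : 0 < u -> u < v -> u `^ k < v `^ k.
  by move=> u0 uv; apply: gt0_ltr_powR => //; rewrite ?nnegrE; lra.
have gap := @powR_convex_gap R k s x y k1 (ltW s0) x0 y0.
have pos0 : 0 < s `^ k by exact: powR_gt0.
have pos_x := incr s (s + x) s0 ltac:(lra).
have pos_y := incr s (s + y) s0 ltac:(lra).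
have pos_xy := incr (s + x) (s + x + y) ltac:(lra) ltac:(lra).
have pos_yx := incr (s + y) (s + x + y) ltac:(lra) ltac:(lra).
rewrite /g !powRN; move: gap pos0 pos_x pos_y pos_xy pos_yx.
move: (s `^ k) ((s + x) `^ k) ((s + y) `^ k) ((s + x + y) `^ k).
(* The indices 1, 2, 3, 4 stand for the sides 12, 23, 34, 14: [f1] belongs to the longest side and
   [f3] to the shortest. Each [f] is a value of [1 / g]. *)
move=> f3 f2 f4 f1 gap f30 f32 f34 f21 f41 l1.
have f10 : 0 < f1 by lra.
have f20 : 0 < f2 by lra.
have f40 : 0 < f4 by lra.
have gap' : (f2^-1 - f1^-1) * (f3^-1 * f4^-1) >=
            (f3^-1 - f4^-1) * (f1^-1 * f2^-1).
  rewrite -subr_ge0.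
  have -> : (f2^-1 - f1^-1) * (f3^-1 * f4^-1) -
      (f3^-1 - f4^-1) * (f1^-1 * f2^-1) =
      (f3 + f1 - (f2 + f4)) / (f1 * f2 * f3 * f4).
    by field; rewrite !gt_eqF.
  by apply: divr_ge0; [lra | rewrite !mulr_ge0 ?ltW].
have g12 : f1^-1 < f2^-1 by rewrite ltf_pV2 ?posrE.
have g14 : f1^-1 < f4^-1 by rewrite ltf_pV2 ?posrE.
have g23 : f2^-1 < f3^-1 by rewrite ltf_pV2 ?posrE.
have g43 : f4^-1 < f3^-1 by rewrite ltf_pV2 ?posrE.
move: gap' l1 g12 g14 g23 g43 {f10 f20 f30 f40 gap f32 f34 f21 f41}.
move: (f1^-1) (f2^-1) (f3^-1) (f4^-1) => g1 g2 g3 g4.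
move=> gap l1 g12 g14 g23 g43 e1 e2.
(* The bound from below on [A / D], multiplied out. It uses [(B - A) D = A (C - D)], a form of
   [A C = B D], and the positivity of [B - A]. *)
have lower : (g4 - l) * (g1 * g2) <= (g1 - l) * (g3 * g4).
  have g21 : 0 < g2 - g1 by lra.
  rewrite -(ler_pM2l g21).
  have -> : (g2 - g1) * ((g4 - l) * (g1 * g2)) =
            (g1 - l) * ((g3 - g4) * (g1 * g2)).
    suff -> : (g1 - l) * ((g3 - g4) * (g1 * g2)) =
      ((g1 - l) * (g3 - l) - (g1 - l) * (g4 - l)) * (g1 * g2).
      by rewrite e1; ring.
    by ring.
  rewrite [leRHS]mulrCA; apply: ler_wpM2l => //; lra.
(* By [A C = E' F'] and [B D = E' F'], one has [A (C + E') = E' (A + F')] and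
   [D (B + E') = E' (D + F')]; hence both sides equal [E' (A + F') (D + F')]. *)
have cross :
    (g1 - l) * ((g3 - G) * (g4 - H)) = (g4 - l) * ((g1 - H) * (g2 - G)).
  transitivity ((l - G) * ((g1 - H) * (g4 - H))).
    have -> : (g1 - l) * ((g3 - G) * (g4 - H)) =
      ((g1 - l) * (g3 - l) + (g1 - l) * (l - G)) * (g4 - H) by ring.
    by rewrite e2; ring.
  have -> : (g4 - l) * ((g1 - H) * (g2 - G)) =
    ((g2 - l) * (g4 - l) + (g4 - l) * (l - G)) * (g1 - H) by ring.
  by rewrite -e1 e2; ring.
(* Subtracting a positive constant from both terms of a fraction smaller than 1 decreases it: here
   [g1 / g4], and next [g2 / g3]. *)
have cut1 : (g1 - H) * g4 < g1 * (g4 - H) by nra.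
have cut2 : (g2 - G) * g3 < g2 * (g3 - G) by nra.
have cut :
    ((g1 - H) * g4) * ((g2 - G) * g3) < (g1 * (g4 - H)) * (g2 * (g3 - G)).
  by apply: ltr_pM => //; apply: mulr_ge0; lra.
have pos : 0 < (g3 - G) * (g4 - H) by apply: mulr_gt0; lra.
suff : (g1 - l) * (g3 * g4) < (g4 - l) * (g1 * g2) by lra.
rewrite -(ltr_pM2l pos).
have -> : (g3 - G) * (g4 - H) * ((g1 - l) * (g3 * g4)) =
  (g1 - l) * ((g3 - G) * (g4 - H)) * (g3 * g4) by ring.
rewrite cross.
have -> : (g4 - l) * ((g1 - H) * (g2 - G)) * (g3 * g4) =
  (g4 - l) * (((g1 - H) * g4) * ((g2 - G) * g3)) by ring.
have -> : (g3 - G) * (g4 - H) * ((g4 - l) * (g1 * g2)) =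
  (g4 - l) * ((g1 * (g4 - H)) * (g2 * (g3 - G))) by ring.
rewrite ltr_pM2l //; lra.
Qed.

(** Here [p], [q] and [x], [y] are the squared pieces of the two diagonals, so the squared sides are
    their sums by Pythagoras. Exchanging [p] with [q], or [x] with [y], permutes the sides and
    respects the relations. This makes [q + y] the shortest squared side, with increments [p - q]
    and [x - y], and [dziobek_no_gap] excludes that both are positive. *)
Lemma dziobek_rectangle (R : realType) (k p q x y l G H : R) :
  let g r := r `^ (- k) in
  1 <= k -> 0 < p -> 0 < q -> 0 < x -> 0 < y ->
  0 < G -> 0 < H -> G < l -> H < l ->
  l < g (p + x) -> l < g (q + x) -> l < g (p + y) -> l < g (q + y) ->
  (g (p + x) - l) * (g (q + y) - l) = (g (q + x) - l) * (g (p + y) - l) ->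
  (g (p + x) - l) * (g (q + y) - l) = (l - G) * (l - H) ->
  p = q \/ x = y.
Proof.
move=> g k1.
wlog pq : p q / q <= p => [wlg|].
  move=> p0 q0 x0 y0 G0 H0 Gl Hl px qx py qy e1 e2.
  have [qp|/ltW pq] := leP q p; first exact: (wlg p q).
  suff : q = p \/ x = y by case; auto.
  by apply: (wlg q p) => //; rewrite -e1.
wlog xy : x y / y <= x => [wlg|].
  move=> p0 q0 x0 y0 G0 H0 Gl Hl px qx py qy e1 e2.
  have [yx|/ltW xy] := leP y x; first exact: (wlg x y).
  suff : p = q \/ y = x by case; auto.
  by apply: (wlg y x) => //; rewrite mulrC -e1 // mulrC.
move=> p0 q0 x0 y0 G0 H0 Gl Hl px qx py qy e1 e2.
have [->|pq'] := eqVneq p q; first by left.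
have [->|xy'] := eqVneq x y; first by right.
have {}pq : 0 < p - q by rewrite subr_gt0 lt_neqAle eq_sym pq'.
have {}xy : 0 < x - y by rewrite subr_gt0 lt_neqAle eq_sym xy'.
have ePX : q + y + (p - q) + (x - y) = p + x by ring.
have ePY : q + y + (p - q) = p + y by ring.
have eQX : q + y + (x - y) = q + x by ring.
have qy0 : 0 < q + y by lra.
exfalso; apply: (@dziobek_no_gap R k (q + y) (p - q) (x - y) l G H) => //.
all: rewrite ?ePX ?ePY ?eQX //.
by rewrite e1 mulrC.
Qed.

(** Each equation, once reduced to two terms, says that two unknowns differ by a positive factor,
    hence have the same sign. In suitable products of these equations the masses and ratios
    cancel. *)
Lemma dziobek_relations (R : realType)
    (m1 m2 m3 m4 s t A B C D E F : R) :
  0 < m1 -> 0 < m2 -> 0 < m3 -> 0 < m4 -> 0 < s < 1 -> 0 < t < 1 ->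
  t * (m2 * A) = (1 - t) * (m4 * D) -> t * (m2 * B) = (1 - t) * (m4 * C) ->
  s * (m1 * A) = (1 - s) * (m3 * B) ->
  s * (m2 * A + m4 * D) + m3 * E = 0 -> t * (m1 * A + m3 * B) + m4 * F = 0 ->
  [/\ A * C = B * D, A * C = - E * - F,
      [/\ Num.sg B = Num.sg A, Num.sg C = Num.sg A & Num.sg D = Num.sg A]
    & Num.sg (- E) = Num.sg A /\ Num.sg (- F) = Num.sg A].
Proof.
move=> m10 m20 m30 m40 /andP[s0 s1] /andP[t0 t1].
rewrite -subr_gt0 in s1; rewrite -subr_gt0 in t1.
move=> eAD eBC eAB eE eF.
have nz (a b : R) : 0 < a -> 0 < b -> 0 < a * b := @mulr_gt0 R a b.
(* Splitting [A] as [(1 - t) A + t A] and trading the second part for [D] turns [eE] into a two-term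
   relation; [eF'] is obtained likewise, with [s] and [B]. *)
have eE' : s * (m2 * A) = (1 - t) * (m3 * - E).
  have -> : s * (m2 * A) = s * ((1 - t) * (m2 * A) + t * (m2 * A)) by ring.
  rewrite eAD; have -> : m3 * - E = s * (m2 * A + m4 * D).
    by rewrite mulrN; apply/eqP; rewrite eqr_oppLR -addr_eq0 addrC eE.
  by ring.
have eF' : t * (m1 * A) = (1 - s) * (m4 * - F).
  have -> : t * (m1 * A) = t * ((1 - s) * (m1 * A) + s * (m1 * A)) by ring.
  rewrite eAB; have -> : m4 * - F = t * (m1 * A + m3 * B).
    by rewrite mulrN; apply/eqP; rewrite eqr_oppLR -addr_eq0 addrC eF.
  by ring.
have AC_BD : A * C = B * D.
  have nz1 : t * m2 * ((1 - t) * m4) != 0 by rewrite gt_eqF ?nz.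
  apply: (mulfI nz1); transitivity ((t * (m2 * A)) * ((1 - t) * (m4 * C))).
    by ring.
  by rewrite eAD -eBC; ring.
have AC_EF : A * C = - E * - F.
  have nz1 : (1 - t) * m4 * ((1 - s) * m3) != 0 by rewrite gt_eqF ?nz.
  apply: (mulfI nz1); transitivity ((1 - s) * m3 * A * ((1 - t) * (m4 * C))).
    by ring.
  transitivity (((1 - t) * (m3 * - E)) * ((1 - s) * (m4 * - F))); last by ring.
  rewrite -eBC -eE' -eF'; transitivity (t * m2 * A * ((1 - s) * (m3 * B))).
    by ring.
  by rewrite -eAB; ring.
have sgn (a b c d X Y : R) : 0 < a -> 0 < b -> 0 < c -> 0 < d ->
    a * (b * X) = c * (d * Y) -> Num.sg X = Num.sg Y.
  move=> a0 b0 c0 d0 /(congr1 Num.sg).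
  by rewrite !sgrM (gtr0_sg a0) (gtr0_sg b0) (gtr0_sg c0) (gtr0_sg d0) !mul1r.
have sD := sgn _ _ _ _ _ _ t0 m20 t1 m40 eAD.
have sB := sgn _ _ _ _ _ _ s0 m10 s1 m30 eAB.
have sC := sgn _ _ _ _ _ _ t0 m20 t1 m40 eBC.
have sE := sgn _ _ _ _ _ _ s0 m20 t1 m30 eE'.
have sF := sgn _ _ _ _ _ _ t0 m10 s1 m40 eF'.
by rewrite -sC -sB -sD -sE -sF.
Qed.

(* [m1], [m3] are the masses at the ends of a diagonal of squared length [N],
   which the other diagonal cuts in the ratio [s : 1 - s]; similarly for [m2],
   [m4], [W] and [t]. *)
Lemma perpendicular_balance (R : realType)
    (k m1 m2 m3 m4 l N W s t : R) :
  let g r := r `^ (- k) in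
  let A := g (s ^+ 2 * N + t ^+ 2 * W) - l in
  let B := g ((1 - s) ^+ 2 * N + t ^+ 2 * W) - l in
  let C := g ((1 - s) ^+ 2 * N + (1 - t) ^+ 2 * W) - l in
  let D := g (s ^+ 2 * N + (1 - t) ^+ 2 * W) - l in
  let E := g N - l in
  let F := g W - l in
  1 <= k -> 0 < m1 -> 0 < m2 -> 0 < m3 -> 0 < m4 -> 0 < N -> 0 < W ->
  0 < s < 1 -> 0 < t < 1 ->
  t * (m2 * A) = (1 - t) * (m4 * D) -> t * (m2 * B) = (1 - t) * (m4 * C) ->
  s * (m1 * A) = (1 - s) * (m3 * B) ->
  s * (m2 * A + m4 * D) + m3 * E = 0 -> t * (m1 * A + m3 * B) + m4 * F = 0 ->
  s = 1 - s \/ t = 1 - t.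
Proof.
move=> g A B C D E F k1 m10 m20 m30 m40 N0 W0 s01 t01 eAD eBC eAB eE eF.
have [AC_BD AC_EF [sB sC sD] [sE sF]] :=
  dziobek_relations m10 m20 m30 m40 s01 t01 eAD eBC eAB eE eF.
have /andP[s0 s1] := s01; have /andP[t0 t1] := t01.
rewrite -subr_gt0 in s1; rewrite -subr_gt0 in t1.
have nz (a b : R) : 0 < a -> 0 < b -> 0 < a * b := @mulr_gt0 R a b.
have sq0 (a b : R) : 0 < a -> 0 < b -> 0 < a ^+ 2 * b.
  by move=> *; rewrite nz ?exprn_gt0.
have p0 := sq0 _ _ s0 N0; have q0 := sq0 _ _ s1 N0.
have x0 := sq0 _ _ t0 W0; have y0 := sq0 _ _ t1 W0.
have k0 : 0 < k by exact: lt_le_trans ltr01 k1.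
have decr a b : 0 < a -> 0 < b -> g a < g b -> b < a.
  move=> a0 b0; rewrite /g !powRN ltf_pV2 ?posrE ?powR_gt0 //.
  apply: contraTT; rewrite -!leNgt => ab.
  by apply: ge0_ler_powR => //; rewrite ?nnegrE ltW.
have half (a b K : R) :
    0 < K -> 0 < a -> 0 < b -> a ^+ 2 * K = b ^+ 2 * K -> a = b.
  move=> K0 a0 b0 /(mulIf (lt0r_neq0 K0)) /eqP.
  by rewrite eqrXn2 ?ltW // => /eqP.
have [A0|A0|A0] := ltgtP 0 A.
- have [B0 C0 D0 E0 F0] : [/\ 0 < B, 0 < C, 0 < D, 0 < - E & 0 < - F].
    rewrite -(sgr_gt0 B) -(sgr_gt0 C) -(sgr_gt0 D) -(sgr_gt0 (- E)).
    by rewrite -(sgr_gt0 (- F)) sB sC sD sE sF !sgr_gt0.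
  have GE : 0 < g N by exact: powR_gt0.
  have GF : 0 < g W by exact: powR_gt0.
  case: (@dziobek_rectangle R k (s ^+ 2 * N) ((1 - s) ^+ 2 * N) (t ^+ 2 * W)
    ((1 - t) ^+ 2 * W) l (g N) (g W)).
  1-7: by [].
  1,2: by rewrite -subr_gt0 -opprB.
  1-4: by rewrite -subr_gt0.
  1: exact: AC_BD.
  1: by rewrite -(opprB (g N)) -(opprB (g W)); exact: AC_EF.
  1: by move/(half _ _ _ N0 s0 s1); left.
  by move/(half _ _ _ W0 t0 t1); right.
- have [B0 C0 D0 E0 F0] : [/\ B < 0, C < 0, D < 0, - E < 0 & - F < 0].
    rewrite -(sgr_lt0 B) -(sgr_lt0 C) -(sgr_lt0 D) -(sgr_lt0 (- E)).
    by rewrite -(sgr_lt0 (- F)) sB sC sD sE sF !sgr_lt0.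
  have side a b K : 0 < a -> 0 < b -> 0 < K -> g (a + b) - l < 0 ->
      - (g K - l) < 0 -> K < a + b.
    move=> a0 b0 K0; rewrite subr_lt0 oppr_lt0 subr_gt0 => h1 h2.
    by apply: decr => //; [exact: addr_gt0 | exact: lt_trans h2].
  (* The four squared sides sum to less than twice the squared diagonals. *)
  have h1 := side _ _ _ p0 x0 N0 A0 E0; have h2 := side _ _ _ q0 y0 N0 C0 E0.
  have h3 := side _ _ _ p0 x0 W0 A0 F0; have h4 := side _ _ _ q0 y0 W0 C0 F0.
  have eN : s ^+ 2 * N + (1 - s) ^+ 2 * N = N - 2 * (s * (1 - s) * N) by ring.
  have eW : t ^+ 2 * W + (1 - t) ^+ 2 * W = W - 2 * (t * (1 - t) * W) by ring.
  have hN : 0 < s * (1 - s) * N by rewrite !nz.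
  have hW : 0 < t * (1 - t) * W by rewrite !nz.
  clear - h1 h2 h3 h4 eN eW hN hW; lra.
(* When [A] vanishes so does [B]: the sides 12 and 23 are equal, and the foot of the perpendicular
   bisects the diagonal 13. *)
- have B0 : B = 0 by apply/eqP; rewrite -sgr_eq0 sB -A0 sgr0.
  have : g (s ^+ 2 * N + t ^+ 2 * W) = g ((1 - s) ^+ 2 * N + t ^+ 2 * W).
    by rewrite -[LHS](subrK l) -[RHS](subrK l) -/A -/B B0 -A0.
  have pw := addr_gt0 p0 x0; have qw := addr_gt0 q0 x0.
  rewrite /g !powRN => /invr_inj /(powR_injective k0).
  rewrite !nnegrE !ltW // => /(_ erefl erefl) /addIr.
  by move/(half _ _ _ N0 s0 s1); left.
Qed.

(** * The Euclidean inner product *)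

Section DotProduct.
Variable R : realType.
Implicit Types (u v w : 'rV[R]_2) (a : R).

Lemma dotpC u v : dotp u v = dotp v u.
Proof. by apply: eq_bigr => j _; rewrite mulrC. Qed.

Lemma dotpDl u v w : dotp (u + v) w = dotp u w + dotp v w.
Proof. by rewrite -big_split /=; apply: eq_bigr => j _; rewrite mxE mulrDl. Qed.

Lemma dotpZl a u v : dotp (a *: u) v = a * dotp u v.
Proof. by rewrite mulr_sumr; apply: eq_bigr => j _; rewrite mxE mulrA. Qed.

Lemma dotpNl u v : dotp (- u) v = - dotp u v.
Proof. by rewrite -scaleN1r dotpZl mulN1r. Qed.

Lemma dotp0l v : dotp 0 v = 0.
Proof. by rewrite -(scale0r v) dotpZl mul0r. Qed.

Lemma dotp_suml (I : Type) (r : seq I) (a : I -> R) (u : I -> 'rV[R]_2) v :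
  dotp (\sum_(i <- r) a i *: u i) v = \sum_(i <- r) a i * dotp (u i) v.
Proof.
elim: r => [|i r IHr]; first by rewrite !big_nil dotp0l.
by rewrite !big_cons dotpDl dotpZl IHr.
Qed.

Lemma dotpDr u v w : dotp u (v + w) = dotp u v + dotp u w.
Proof. by rewrite dotpC dotpDl !(dotpC u). Qed.

Lemma dotpNr u v : dotp u (- v) = - dotp u v.
Proof. by rewrite dotpC dotpNl dotpC. Qed.

Lemma dotpZr a u v : dotp u (a *: v) = a * dotp u v.
Proof. by rewrite dotpC dotpZl dotpC. Qed.

Lemma dotp_addZ a u v : dotp (u + a *: v) (u + a *: v) =
  dotp u u + a * (2 * dotp u v) + a ^+ 2 * dotp v v.
Proof.
by rewrite dotpDl !dotpDr !dotpZl !dotpZr (dotpC v u); ring.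
Qed.

Lemma dotp_ge0 u : 0 <= dotp u u.
Proof. by apply: sumr_ge0 => j _; rewrite -expr2 sqr_ge0. Qed.

Lemma dotp_gt0 u : u != 0 -> 0 < dotp u u.
Proof.
move=> u0; rewrite lt_def dotp_ge0 andbT; apply: contra u0.
rewrite psumr_eq0 => [/allP u0|j _]; last by rewrite -expr2 sqr_ge0.
apply/eqP/rowP => j; rewrite mxE; apply/eqP.
by have := u0 j (mem_index_enum j); rewrite /= mulf_eq0 orbb.
Qed.

End DotProduct.

(** * Lagrange's equations of a central configuration *)

Lemma is_derive_bigsum (R : numFieldType) (V W : normedModType R) (I : Type)
    (r : seq I) (P : pred I) (h : I -> V -> W) (dh : I -> W) (x v : V) :
  (forall i, P i -> is_derive x v (h i) (dh i)) ->
  is_derive x v (fun t => \sum_(i <- r | P i) h i t) (\sum_(i <- r | P i) dh i).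
Proof.
move=> dhi; elim: r => [|i r IHr].
  rewrite big_nil (_ : (fun t => _) = cst 0); first exact: is_derive_cst.
  by apply/funext => t; rewrite big_nil.
rewrite big_cons; case: ifP => Pi.
  rewrite (_ : (fun t => _) = h i + (fun t => \sum_(i <- r | P i) h i t)).
    by apply: is_deriveD; exact: dhi.
  by apply/funext => t; rewrite big_cons Pi.
rewrite (_ : (fun t => _) = (fun t => \sum_(i <- r | P i) h i t)) //.
by apply/funext => t; rewrite big_cons Pi.
Qed.

(** Sums over pairs become sums over the full square, where the two indices separate. *)
Lemma sum_ltn_symmetric (R : nzRingType) n (F : 'I_n -> 'I_n -> R) :
  (forall i j, F i j = F j i) -> (forall i, F i i = 0) ->
  \sum_(i < n) \sum_(j < n) F i j =
    2 * \sum_(i < n) \sum_(j < n | (i < j)%N) F i j.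
Proof.
move=> Fsym F0; rewrite mulr_natl mulr2n.
have -> : \sum_(i < n) \sum_(j < n) F i j =
    \sum_(i < n) (\sum_(j < n | (i < j)%N) F i j +
    \sum_(j < n | (j < i)%N) F i j).
  apply: eq_bigr => i _; rewrite (bigID (fun j : 'I_n => (i < j)%N)) /=.
  congr (_ + _); rewrite (bigD1 i) ?ltnn //= F0 add0r.
  by apply: eq_bigl => j; rewrite -leqNgt ltn_neqAle andbC.
rewrite big_split /=; congr (_ + _).
rewrite (exchange_big_dep xpredT) //=.
by apply: eq_bigr => i _; apply: eq_bigr => j _; exact: Fsym.
Qed.

Section Gradient.
Variable R : realType.
Implicit Types (q v : configuration R) (m : 'I_4 -> R) (alpha : R).

Let rel q (i j : 'I_4) := row i q - row j q.

Lemma dist_bodies_powR alpha q i j :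
  dist_bodies q i j `^ (- alpha) =
    (dotp (rel q i j) (rel q i j)) `^ (- (alpha / 2)).
Proof.
rewrite /dist_bodies /enorm -powR12_sqrt ?dotp_ge0 // -powRrM.
by congr (_ `^ _); rewrite mulrN mulrC.
Qed.

(** Expand the squared mutual distances around the center of mass: the cross terms vanish because
    the weighted positions [y] sum to zero. *)
Lemma inertia_pairs m q : total_mass m != 0 ->
  inertia m q = (total_mass m)^-1 * \sum_(i < 4) \sum_(j < 4 | (i < j)%N)
    (m i * m j * dotp (rel q i j) (rel q i j)).
Proof.
move=> M0; set c := center_of_mass m q; set M := total_mass m in M0 *.
pose y i := row i q - c.
have y0 : \sum_i m i *: y i = 0.
  under eq_bigr do rewrite scalerBr.
  rewrite sumrB -scaler_suml -/(total_mass m) -/M /c /center_of_mass -/M.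
  by rewrite scalerA divff // scale1r subrr.
have relE i j : rel q i j = y i - y j by rewrite /y opprB addrA subrK.
have -> : inertia m q = \sum_i m i * dotp (y i) (y i).
  by apply: eq_bigr => i _; rewrite sqr_sqrtr ?dotp_ge0.
clearbody y; have two0 : (2 : R) != 0 by rewrite pnatr_eq0.
apply: (mulfI M0); rewrite mulrA divff // mul1r; apply: (mulfI two0).
rewrite -(@sum_ltn_symmetric R 4
  (fun i j => m i * m j * dotp (rel q i j) (rel q i j))); last 2 first.
- by move=> i j; rewrite !relE -opprB dotpNl dotpNr opprK (mulrC (m i)).
- by move=> i; rewrite relE subrr dotp0l mulr0.
(* The subtracted term is zero by [y0]; it is inserted so that both sides agree term by term. *)
transitivity (\sum_i (m i * dotp (y i) (y i) * M +
    m i * \sum_j m j * dotp (y j) (y j) -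
    2 * m i * dotp (y i) (\sum_j m j *: y j))).
  under [RHS]eq_bigr do rewrite y0 dotpC dotp0l mulr0 subr0.
  rewrite big_split /= -!mulr_suml -[X in _ = _ + X * _]/M; ring.
apply: eq_bigr => i _.
rewrite dotpC dotp_suml /M /total_mass [_ * dotp _ _ * _]mulr_sumr.
rewrite [m i * \sum_(j < 4) _]mulr_sumr [2 * m i * _]mulr_sumr.
rewrite -big_split -sumrB /=.
apply: eq_bigr => j _.
rewrite relE dotpDl !dotpDr !dotpNl !dotpNr (dotpC (y i) (y j)). ring.
Qed.

(** Lagrange's equations tested on a displacement [v]. The constrained curve is explicit: the
    inertia is translation invariant and homogeneous of degree 2, so a rescaling brings the line
    [q + t *: v] back to its level set. *)
Lemma central_configuration_gradient alpha m q :
  alpha != 0 -> (forall i, 0 < m i) -> central_configuration alpha m q ->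
  exists l : R, forall v, \sum_(i < 4) \sum_(j < 4 | (i < j)%N)
    m i * m j * ((dotp (rel q i j) (rel q i j) `^ (- (alpha / 2 + 1)) - l) *
      dotp (rel q i j) (rel v i j)) = 0.
Proof.
move=> alpha0 m0 [I0 [I0_gt0 [[q_nc q_I] q_crit]]].
have M0 : 0 < total_mass m.
  rewrite /total_mass big_ord_recl ltr_wpDr ?m0 //.
  by apply: sumr_ge0 => i _; exact: ltW.
pose rho i j := dotp (rel q i j) (rel q i j).
pose w i j := m i * m j.
pose S := \sum_(i < 4) \sum_(j < 4 | (i < j)%N)
  w i j * (rho i j `^ (- (alpha / 2 + 1)) * rho i j).
(* The multiplier is dictated by [v = q]: the equation then reads [S = l * (total_mass m * I0)], by
   the pair formula for the inertia. *)
exists (S / (total_mass m * I0)) => v.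
pose beta i j := dotp (rel q i j) (rel v i j).
pose Q i j (t : R) :=
  rho i j + t * (2 * beta i j) + t ^+ 2 * dotp (rel v i j) (rel v i j).
have relE i j t : dotp (rel (q + t *: v) i j) (rel (q + t *: v) i j) = Q i j t.
  have -> : rel (q + t *: v) i j = rel q i j + t *: rel v i j.
    by apply/rowP => k; rewrite !mxE; ring.
  by rewrite dotp_addZ.
pose J t := inertia m (q + t *: v).
have JE t : J t = (total_mass m)^-1 *
    \sum_(i < 4) \sum_(j < 4 | (i < j)%N) w i j * Q i j t.
  rewrite /J inertia_pairs ?gt_eqF //; congr (_ * _).
  by apply: eq_bigr => i _; apply: eq_bigr => j _; rewrite relE.
have J0 : J 0 = I0 by rewrite /J scale0r addr0.
have J_ge0 t : 0 <= J t.
  by apply: sumr_ge0 => i _; rewrite mulr_ge0 ?sqr_ge0 // ltW.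
have Q0 i j : Q i j 0 = rho i j by rewrite /Q expr0n /= !mul0r !addr0.
have rho_gt0 i j : i != j -> 0 < rho i j.
  move=> ij; apply: dotp_gt0; rewrite subr_eq0; apply: contra ij => /eqP qij.
  by apply/eqP; exact: q_nc.
have dQ i j : is_derive (0 : R) (1 : R) (Q i j) (2 * beta i j).
  have -> : Q i j = cst (rho i j) + (2 * beta i j) \*: id +
      dotp (rel v i j) (rel v i j) \*: ((id : R -> R) * id).
    apply/funext => t.
    transitivity (rho i j + 2 * beta i j * t +
      dotp (rel v i j) (rel v i j) * (t * t)).
      by rewrite /Q; ring.
    by [].
  apply: is_derive_eq. by rewrite /GRing.scale /=; ring.
pose B := (total_mass m)^-1 *
  \sum_(i < 4) \sum_(j < 4 | (i < j)%N) w i j * (2 * beta i j).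
have dJ : is_derive (0 : R) (1 : R) J B.
  have -> : J = (total_mass m)^-1 \*: (fun t =>
      \sum_(i < 4) \sum_(j < 4 | (i < j)%N) w i j * Q i j t).
    by apply/funext => t; rewrite JE.
  apply: is_deriveZ; apply: is_derive_bigsum => i _.
  apply: is_derive_bigsum => j _; exact: (is_deriveZ (w i j) (dQ i j)).
pose phi t := Num.sqrt (I0 / J t).
(* The line [q + t *: v] rescaled to stay on the level set of the inertia. *)
pose gamma t : configuration R := phi t *: (q + t *: v).
(* This holds even where [J t] vanishes, since the inverse of 0 is 0. *)
have phi2 t : phi t ^+ 2 = I0 / J t by rewrite sqr_sqrtr // divr_ge0 // ltW.
have relgE i j t :
    dotp (rel (gamma t) i j) (rel (gamma t) i j) = I0 / J t * Q i j t.
  have -> : rel (gamma t) i j = phi t *: rel (q + t *: v) i j.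
    by apply/rowP => k; rewrite !mxE; ring.
  by rewrite dotpZl dotpZr relE mulrA -expr2 phi2.
have U_E : potential alpha m \o gamma =
    (fun t => \sum_(i < 4) \sum_(j < 4 | (i < j)%N)
    w i j * (I0 / J t * Q i j t) `^ (- (alpha / 2))).
  apply/funext => t; rewrite /= /potential.
  by do 2![apply: eq_bigr => ? _]; rewrite dist_bodies_powR relgE.
have gamma0 : gamma 0 = q.
  by rewrite /gamma /phi J0 divff ?gt_eqF // sqrtr1 scale1r scale0r addr0.
have dJV : is_derive (0 : R) (1 : R) (fun t => I0 / J t) (- (B / I0)).
  have J00 : J 0 != 0 by rewrite J0 gt_eqF.
  apply: is_derive_eq (is_deriveZ I0 (is_deriveV J00 dJ)) _.
  by rewrite J0 /GRing.scale /=; field; rewrite gt_eqF.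
have dphi : derivable phi 0 1.
  have J0V : 0 < I0 / J 0 by rewrite J0 divff // gt_eqF.
  by have [] := @is_derive1_comp R Num.sqrt (fun t => I0 / J t) 0 _ _
    (is_derive1_sqrt J0V) dJV.
have dgamma : derivable gamma 0 1.
  apply/derivable_mxP => i j.
  have -> : (fun t => gamma t i j) = phi * (cst (q i j) + v i j \*: id).
    by apply/funext => t; rewrite /gamma !mxE [t * _]mulrC.
  by apply: derivableM => //; apply: ex_derive.
have pos_near (f : R -> R) df : is_derive (0 : R) (1 : R) f df -> 0 < f 0 ->
    \forall t \near (0 : R), 0 < f t.
  move=> [/derivable1_diffP /differentiable_continuous fc _] f0.
  exact: (cvgr_gt (f 0) fc _ f0).
(* Near 0, [J] stays positive, so the rescaling restores the inertia, and the finitely many [Q i j]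
   with [i != j] stay positive, so no collision occurs. *)
have gammaS : \forall t \near (0 : R),
    [set p : configuration R | noncollision p /\ inertia m p = I0]%classic
      (gamma t).
  have J_near : \forall t \near (0 : R), 0 < J t.
    by apply: pos_near dJ _; rewrite J0.
  have Q_near : \forall t \near (0 : R),
      forall i j : 'I_4, i != j -> 0 < Q i j t.
    suff near_ij (i j : 'I_4) : \forall t \near (0 : R), i != j -> 0 < Q i j t.
      pose P i t := forall j, i != j -> 0 < Q i j t.
      have near_i i : \forall t \near (0 : R), P i t.
        exact: (filter_forall (nbhs_filter (0 : R)) (near_ij i)).
      exact: (filter_forall (nbhs_filter (0 : R)) near_i).
    have [->|ij] := eqVneq i j.
      by apply: (filterE (nbhs_filter (0 : R))) => t.
    have := pos_near _ _ (dQ i j); rewrite Q0 => /(_ (rho_gt0 _ _ ij)).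
    by apply: filterS => t.
  near=> t.
  have Jt : 0 < J t by near: t.
  have Qt : forall i j : 'I_4, i != j -> 0 < Q i j t by near: t.
  split=> [i j /= rows_eq|].
    apply/eqP; apply: contraT => ij.
    have : 0 < I0 / J t * Q i j t by rewrite mulr_gt0 ?divr_gt0 ?Qt.
    by rewrite -relgE /rel rows_eq subrr dotp0l ltxx.
  transitivity (I0 / J t * J t); last by rewrite divfK // gt_eqF.
  rewrite inertia_pairs ?gt_eqF // JE mulrCA; congr (_ * _).
  rewrite mulr_sumr; apply: eq_bigr => i _; rewrite mulr_sumr.
  by apply: eq_bigr => j _; rewrite relgE JE mulrCA.
have := q_crit gamma gamma0 dgamma gammaS; rewrite U_E => dU0.
have dU : is_derive (0 : R) (1 : R)
    (fun t => \sum_(i < 4) \sum_(j < 4 | (i < j)%N)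
      w i j * (I0 / J t * Q i j t) `^ (- (alpha / 2)))
    (\sum_(i < 4) \sum_(j < 4 | (i < j)%N)
      w i j * (- (alpha / 2) * (rho i j `^ (- (alpha / 2) - 1)) *
        (2 * beta i j - B / I0 * rho i j))).
  apply: is_derive_bigsum => i _; apply: is_derive_bigsum => j ij.
  have J0V : 0 < I0 / J 0 * Q i j 0.
    by rewrite J0 divff ?gt_eqF // mul1r Q0 rho_gt0 // neq_ltn ij.
  have dJQ := is_deriveM dJV (dQ i j).
  have dpow := @is_derive1_comp R (@powR R ^~ (- (alpha / 2)))
    (fun t => I0 / J t * Q i j t) 0 _ _ (@is_derive1_powR R _ _ J0V) dJQ.
  apply: is_derive_eq (is_deriveZ (w i j) dpow) _.
  rewrite /= J0 divff ?gt_eqF // mul1r Q0 /GRing.scale /=.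
  by rewrite mul1r mulrN [rho i j * _]mulrC.
have lin (a b : R) (F G H : 'I_4 -> 'I_4 -> R) :
    (forall i j, i != j -> F i j = a * G i j + b * H i j) ->
    \sum_(i < 4) \sum_(j < 4 | (i < j)%N) F i j =
    a * \sum_(i < 4) \sum_(j < 4 | (i < j)%N) G i j +
    b * \sum_(i < 4) \sum_(j < 4 | (i < j)%N) H i j.
  move=> FGH; rewrite !mulr_sumr -big_split /=; apply: eq_bigr => i _.
  rewrite !mulr_sumr -big_split /=; apply: eq_bigr => j ij; apply: FGH.
  by rewrite neq_ltn ij.
have Bd : B = 2 / total_mass m *
    \sum_(i < 4) \sum_(j < 4 | (i < j)%N) w i j * beta i j.
  rewrite /B (lin 2 0 _ (fun i j => w i j * beta i j) (fun _ _ => 0)).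
    by rewrite mul0r addr0 mulrA [2 / _]mulrC.
  by move=> i j _; ring.
rewrite (lin 1 (- (S / (total_mass m * I0)))
  (fun _ _ => _)
  (fun i j => w i j * (rho i j `^ (- (alpha / 2 + 1)) * beta i j))
  (fun i j => w i j * beta i j)); last first.
  by move=> i j _; rewrite -/(w i j) -/(rho i j) -/(beta i j); ring.
have term i j : i != j ->
    w i j * (- (alpha / 2) * (rho i j `^ (- (alpha / 2) - 1)) *
      (2 * beta i j - B / I0 * rho i j)) =
    - alpha * (w i j * (rho i j `^ (- (alpha / 2 + 1)) * beta i j)) +
    alpha / 2 * (B / I0) * (w i j * (rho i j `^ (- (alpha / 2 + 1)) * rho i j)).
  move=> _; rewrite opprD; move: (B / I0) (rho i j `^ _) => B' P.
  by move: (w i j) (beta i j) (rho i j) => *; field.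
(* The derivative along [gamma] is 0 by criticality and is also given by the chain rule; comparing
   the two values yields the equation up to the factor [alpha]. *)
have [_ dU0E] := dU0; have [_] := dU; rewrite dU0E => balance.
have {}balance := etrans balance (lin _ _ _ _ _ term).
rewrite -/S Bd in balance; rewrite mul1r mulNr.
apply: (mulfI alpha0); rewrite mulr0 -[RHS]oppr0 [in RHS]balance.
by field; rewrite (gt_eqF M0) (gt_eqF I0_gt0).
Unshelve. all: by end_near. Qed.

End Gradient.

(** The gradient equation is tested on the displacement that moves body [i] alone along [w]. The
    term [j = i] contributes 0 through its inner product. *)
Lemma central_configuration_balance (R : realType) (alpha : R) m
    (q : configuration R) :
  alpha != 0 -> (forall i, 0 < m i) -> central_configuration alpha m q ->
  exists l : R, forall (i : 'I_4) (w : 'rV[R]_2),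
    \sum_(j < 4) m j * ((dotp (row i q - row j q) (row i q - row j q)
      `^ (- (alpha / 2 + 1)) - l) * dotp (row i q - row j q) w) = 0.
Proof.
move=> alpha0 m0 /(central_configuration_gradient alpha0 m0) [l grad].
exists l => i w.
pose r a b := row a q - row b q.
pose g a b := dotp (r a b) (r a b) `^ (- (alpha / 2 + 1)) - l.
pose v : configuration R := \matrix_(a, b) ((a == i)%:R * w 0 b).
have rv a b : row a v - row b v = ((a == i)%:R - (b == i)%:R) *: w.
  by apply/rowP => c; rewrite !mxE mulrBl.
pose F a b := m a * m b * (g a b * dotp (r a b) (row a v - row b v)).
pose G a b := m a * m b * (g a b * dotp (r a b) w).
have rC a b : r b a = - r a b by rewrite /r opprB.
have gC a b : g a b = g b a.
  by rewrite /g (rC a b) dotpNl dotpNr opprK.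
have FE a b : F a b = (a == i)%:R * G a b + (b == i)%:R * G b a.
  rewrite /F /G rv dotpZr (gC b a) (rC a b) dotpNl; ring.
have Faa a : F a a = 0 by rewrite /F rv subrr scale0r dotpC dotp0l !mulr0.
have Fsym a b : F a b = F b a by rewrite !FE addrC.
(* On the full square, body [i] is met once as first and once as second index, so the sum is twice
   that of [G i]. *)
have := sum_ltn_symmetric Fsym Faa; rewrite [X in _ = 2 * X]grad mulr0.
have pick (H : 'I_4 -> R) : \sum_a (a == i)%:R * H a = H i.
  rewrite (bigD1 i) //= eqxx mul1r big1 ?addr0 // => a /negPf ->.
  by rewrite mul0r.
under eq_bigr do under eq_bigr do rewrite FE.
under eq_bigr do rewrite big_split /= -mulr_sumr pick.
rewrite big_split /= pick => /eqP.
rewrite -mulr2n mulrn_eq0 /= /G => /eqP sum0.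
apply: (mulfI (lt0r_neq0 (m0 i))); rewrite mulr0 -[RHS]sum0 mulr_sumr.
by apply: eq_bigr => j _; rewrite mulrA.
Qed.

(** * Geometry of the crossing diagonals *)

Lemma mem_four_labels (i j k l : 'I_4) x :
  uniq [:: i; j; k; l] -> x \in [:: i; j; k; l].
Proof.
move=> ijkl.
have card4 : #|[:: i; j; k; l]| = #|'I_4| by rewrite card_ord; exact/card_uniqP.
by rewrite (subset_cardP card4 (subset_predT _)).
Qed.

Lemma sum_four_labels (i j k l : 'I_4) (V : nmodType) (F : 'I_4 -> V) :
  uniq [:: i; j; k; l] -> \sum_x F x = F i + F j + F k + F l.
Proof.
move=> ijkl.
rewrite (perm_big [:: i; j; k; l]) /=; last first.
  apply: uniq_perm; rewrite ?index_enum_uniq // => x.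
  by rewrite mem_index_enum mem_four_labels.
by rewrite !big_cons big_nil addr0 !addrA.
Qed.

(** Otherwise [n] would be an outward normal and [i j] a side. Used for [n] and [- n], this puts [k]
    and [l] strictly on opposite sides of the diagonal. *)
Lemma opposite_vertices_sides (R : realType) (q : configuration R) i j k l n :
  uniq [:: i; j; k; l] -> opposite_vertices q i j -> n != 0 ->
  dotp n (row j q - row i q) = 0 ->
  0 < dotp n (row k q - row i q) \/ 0 < dotp n (row l q - row i q).
Proof.
move=> ijkl [_ nside] n0 nij.
have [|hk] := ltP 0 (dotp n (row k q - row i q)); first by left.
have [|hl] := ltP 0 (dotp n (row l q - row i q)); first by right.
case: nside; exists n; split=> // x.
have := mem_four_labels x ijkl; rewrite !inE => /or4P[] /eqP -> //.
  by rewrite subrr dotpC dotp0l.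
by rewrite nij.
Qed.

(** The remainder is orthogonal to both [u] and [w], hence zero by Cramer's rule. *)
Lemma orthogonal_decomposition (R : realType) (u w x : 'rV[R]_2) :
  u != 0 -> w != 0 -> dotp u w = 0 ->
  x = (dotp x u / dotp u u) *: u + (dotp x w / dotp w w) *: w.
Proof.
move=> u0 w0 uw.
have N0 := lt0r_neq0 (dotp_gt0 u0); have W0 := lt0r_neq0 (dotp_gt0 w0).
set y := RHS; apply/eqP; rewrite -subr_eq0; apply/eqP.
have zu : dotp (x - y) u = 0.
  by rewrite dotpDl dotpNl dotpDl !dotpZl (dotpC w) uw mulr0 addr0 divfK ?subrr.
have zw : dotp (x - y) w = 0.
  by rewrite dotpDl dotpNl dotpDl !dotpZl uw mulr0 add0r divfK ?subrr.
move: (x - y) zu zw => z {y}.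
have dot2 (a b : 'rV[R]_2) : dotp a b = a 0 0 * b 0 0 + a 0 1 * b 0 1.
  rewrite /dotp !big_ord_recl big_ord0 addr0.
  by congr (_ + a 0 _ * b 0 _); exact: val_inj.
move: N0 W0 uw; rewrite !dot2 => N0 W0 uw zu zw.
pose D := u 0 0 * w 0 1 - u 0 1 * w 0 0.
have D0 : D != 0.
  (* Lagrange's identity: the squared inner product plus the squared determinant is the product of
     the squared norms. *)
  apply: contra_neq (mulf_neq0 N0 W0) => D0.
  transitivity ((u 0 0 * w 0 0 + u 0 1 * w 0 1) ^+ 2 + D ^+ 2).
    by rewrite /D; ring.
  by rewrite uw D0 expr0n addr0.
apply/rowP => c; rewrite mxE; apply: (mulfI D0); rewrite mulr0.
have [->|->] : c = 0 \/ c = 1.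
  by case: c => [[|[|//]]] hc; [left|right]; exact: val_inj.
  transitivity (w 0 1 * (z 0 0 * u 0 0 + z 0 1 * u 0 1) -
    u 0 1 * (z 0 0 * w 0 0 + z 0 1 * w 0 1)); first by rewrite /D; ring.
  by rewrite zu zw !mulr0 subrr.
transitivity (u 0 0 * (z 0 0 * w 0 0 + z 0 1 * w 0 1) -
  w 0 0 * (z 0 0 * u 0 0 + z 0 1 * u 0 1)); first by rewrite /D; ring.
by rewrite zu zw !mulr0 subrr.
Qed.

Lemma dotp_orthogonal (R : realType) (u w : 'rV[R]_2) : dotp u w = 0 ->
  [/\ forall a b, dotp (a *: u + b *: w) (a *: u + b *: w) =
        a ^+ 2 * dotp u u + b ^+ 2 * dotp w w,
      forall a b, dotp (a *: u + b *: w) u = a * dotp u u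
    & forall a b, dotp (a *: u + b *: w) w = b * dotp w w].
Proof.
move=> uw; split=> a b; rewrite dotpDl !dotpZl.
all: by rewrite ?dotpDr ?dotpZr ?(dotpC w u) uw; ring.
Qed.

Lemma noncollision_neq (R : realType) (q : configuration R) a b :
  noncollision q -> a != b -> row b q - row a q != 0.
Proof.
by move=> nc ab; rewrite subr_eq0; apply: contra ab => /eqP /nc ->.
Qed.

(** The crossing point is [row i q + s *: u = row k q + t *: w]. As the diagonals are orthogonal,
    each one is a normal to the other, and separation of its ends bounds its ratio. *)
Lemma crossing_diagonals (R : realType) (q : configuration R) i j k l :
  let u := row j q - row i q in
  let w := row l q - row k q in
  noncollision q -> uniq [:: i; j; k; l] ->
  opposite_vertices q i j -> opposite_vertices q k l -> dotp u w = 0 ->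
  exists s t : R,
    [/\ 0 < s < 1, 0 < t < 1 & row k q - row i q = s *: u - t *: w].
Proof.
move=> u w nc ijkl oij okl uw.
have nz a b := @noncollision_neq R q a b nc.
have klij : uniq [:: k; l; i; j].
  by have := ijkl; rewrite -(rot_uniq 2).
have u0 : u != 0 by apply: nz; move: ijkl; rewrite /= inE negb_or; case: eqP.
have w0 : w != 0 by apply: nz; move: klij; rewrite /= inE negb_or; case: eqP.
have N0 := dotp_gt0 u0; have W0 := dotp_gt0 w0.
pose s := dotp (row k q - row i q) u / dotp u u.
pose t := - (dotp (row k q - row i q) w / dotp w w).
have ki : row k q - row i q = s *: u - t *: w.
  by rewrite /t scaleNr opprK; exact: orthogonal_decomposition.
clearbody s t.
have wu : dotp w u = 0 by rewrite dotpC.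
have li : row l q - row i q = s *: u + (1 - t) *: w.
  by rewrite scalerBl scale1r addrCA -ki addrA subrK.
have jk : row j q - row k q = (1 - s) *: u + t *: w.
  have -> : row j q - row k q = u - (row k q - row i q).
    by rewrite opprB addrA subrK.
  by rewrite ki scalerBl scale1r opprB addrA addrAC.
have ik : row i q - row k q = - s *: u + t *: w.
  by rewrite -[LHS]opprB ki opprB scaleNr addrC.
have Nu0 : - u != 0 by rewrite oppr_eq0.
have Nw0 : - w != 0 by rewrite oppr_eq0.
exists s, t; split=> //.
(* The normal [- u] to the diagonal [k l] gives [0 < s]; the normal [u] then gives [s < 1]. *)
- have s0 : 0 < s.
    have := opposite_vertices_sides klij okl Nu0.
    rewrite !dotpNl uw oppr0 => /(_ erefl).
    rewrite ik jk !dotpDr !dotpZr uw !mulr0 !addr0 -!mulNr !pmulr_lgt0 //; lra.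
  have := opposite_vertices_sides klij okl u0 uw.
  rewrite ik jk !dotpDr !dotpZr uw !mulr0 !addr0 !pmulr_lgt0 //; lra.
- have t0 : 0 < t.
    have := opposite_vertices_sides ijkl oij Nw0.
    rewrite !dotpNl wu oppr0 => /(_ erefl).
    rewrite ki li -scaleNr !dotpDr !dotpZr wu !mulr0 !add0r -!mulNr.
    by rewrite !pmulr_lgt0 //; lra.
  have := opposite_vertices_sides ijkl oij w0 wu.
  rewrite ki li -scaleNr !dotpDr !dotpZr wu !mulr0 !add0r !pmulr_lgt0 //; lra.
Qed.

(** The line [k l] is then the perpendicular bisector of [i j], so it serves as the axis: the
    reflection reverses the [u] coordinate and keeps the [w] coordinate. *)
Lemma kite_bisected (R : realType) (q : configuration R) i j k l (s t : R) :
  let u := row j q - row i q in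
  let w := row l q - row k q in
  uniq [:: k; l; i; j] -> w != 0 -> dotp u w = 0 ->
  row k q - row i q = s *: u - t *: w -> s = 1 - s -> kite q.
Proof.
move=> u w klij w0 uw ki half.
have W0 := lt0r_neq0 (dotp_gt0 w0).
have s2 : s = 1 / 2 by lra.
have jE : row j q = row i q + u by rewrite /u addrC subrK.
have lE : row l q = row k q + w by rewrite /w addrC subrK.
have iE : row i q = row k q - s *: u + t *: w.
  by rewrite -[LHS](subKr (row k q)) ki opprB addrA addrAC.
have refl (a : R) : reflection (row k q) w (row k q + a *: u + t *: w) =
    row k q - a *: u + t *: w.
  rewrite /reflection.
  have -> : row k q + a *: u + t *: w - row k q = a *: u + t *: w.
    by rewrite -[X in X - _]addrA addrAC subrr add0r.
  rewrite dotpDl !dotpZl uw mulr0 add0r.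
  have -> : 2 * (t * dotp w w) / dotp w w = 2 * t by field.
  by rewrite opprD !addrA; apply/rowP => c; rewrite !mxE; ring.
have iE' : row i q = row k q + (- s) *: u + t *: w by rewrite iE scaleNr.
have jE' : row j q = row k q + s *: u + t *: w.
  by rewrite jE iE s2; apply/rowP => c; rewrite !mxE; field.
exists (row k q), w, k, l, i, j; split=> //.
- split; first by exists 0; rewrite ?scale0r ?addr0.
  by exists 1; rewrite // scale1r -lE.
- by rewrite iE' refl scaleNr opprK.
- by rewrite {1}jE' refl.
Qed.

(** * Projection of Lagrange's equations on the diagonals *)

Theorem theorem2p2 (R : realType) (alpha : R) (m : 'I_4 -> R)
    (q : configuration R)
    (alpha_gt0 : 0 < alpha) (m_gt0 : forall i : 'I_4, 0 < m i)
    (q_central : central_configuration alpha m q)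
    (q_convex : convex_configuration q)
    (q_perp : perpendicular_diagonals q) :
  kite q.
Proof.
have [i [j [k [l [ijkl oij okl]]]]] := q_perp.
set u := row j q - row i q; set w := row l q - row k q => uw.
have nc : noncollision q by case: q_central => I0 [_ [[]]].
have [s [t [s01 t01 ki]]] := crossing_diagonals nc ijkl oij okl uw.
have klij : uniq [:: k; l; i; j] by have := ijkl; rewrite -(rot_uniq 2).
have nz a b := @noncollision_neq R q a b nc.
have u0 : u != 0 by apply: nz; move: ijkl; rewrite /= inE negb_or; case: eqP.
have w0 : w != 0 by apply: nz; move: klij; rewrite /= inE negb_or; case: eqP.
have N0 := dotp_gt0 u0; have W0 := dotp_gt0 w0.
have [lambda balance] :=
  central_configuration_balance (lt0r_neq0 alpha_gt0) m_gt0 q_central.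
have rC a b : row a q - row b q = - (row b q - row a q) by rewrite opprB.
have ij : row i q - row j q = - 1 *: u + 0 *: w.
  by rewrite scale0r addr0 scaleN1r opprB.
have kl : row k q - row l q = 0 *: u + - 1 *: w.
  by rewrite scale0r add0r scaleN1r opprB.
have ik : row i q - row k q = - s *: u + t *: w.
  by rewrite -[LHS]opprB ki opprB scaleNr addrC.
have jk : row j q - row k q = (1 - s) *: u + t *: w.
  have -> : row j q - row k q = u - (row k q - row i q).
    by rewrite opprB addrA subrK.
  by rewrite ki scalerBl scale1r opprB addrA addrAC.
have il : row i q - row l q = - s *: u + - (1 - t) *: w.
  have -> : row i q - row l q = row i q - row k q + (row k q - row l q).
    by rewrite addrA subrK.
  by rewrite ik kl; apply/rowP => c; rewrite !mxE; ring.
have jl : row j q - row l q = (1 - s) *: u + - (1 - t) *: w.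
  have -> : row j q - row l q = row j q - row k q + (row k q - row l q).
    by rewrite addrA subrK.
  by rewrite jk kl; apply/rowP => c; rewrite !mxE; ring.
have [sq du dw] := dotp_orthogonal uw.
have opp (a b : R) : - (a *: u + b *: w) = - a *: u + - b *: w.
  by rewrite opprD !scaleNr.
have ji := etrans (rC j i) (etrans (congr1 -%R ij) (opp _ _)).
have ki' := etrans (rC k i) (etrans (congr1 -%R ik) (opp _ _)).
have kj := etrans (rC k j) (etrans (congr1 -%R jk) (opp _ _)).
have k1 : 1 <= alpha / 2 + 1 by lra.
have sum4 F := @sum_four_labels i j k l R F ijkl.
have key : s = 1 - s \/ t = 1 - t.
  have := balance i u; have := balance i w; have := balance j w.
  have := balance k u; have := balance k w.
  rewrite !sum4 !subrr !dotp0l ij ik il ji jk jl ki' kj kl !sq !du !dw.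
  clear - k1 m_gt0 N0 W0 s01 t01.
  move: (dotp u u) (dotp w w) N0 W0 => N W N0 W0 {u w q}.
  rewrite !opprK !sqrrN oppr0 !expr1n !expr0n /= !mul1r !mul0r.
  rewrite !addr0 !add0r !mulr0 !addr0 !add0r.
  have cancel (K X Y Z : R) : 0 < K -> Z = 0 -> K * (X - Y) = Z -> X = Y.
    move=> K0 -> /eqP; rewrite mulf_eq0 (gt_eqF K0) subr_eq0.
    by move=> /eqP.
  move=> ek_w ek ej ei ei_u.
  (* Bodies 1, 2, 3, 4 are [i], [k], [j], [l]. Projecting a body's equation across its own diagonal
     removes the opposite body, which gives the first three relations; projecting along it gives the
     two with [E] and [F]. *)
  apply: (@perpendicular_balance R (alpha / 2 + 1) (m i) (m k) (m j) (m l)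
    lambda N W s t) => //.
  - by apply: (cancel W _ _ _ W0 ei); ring.
  - by apply: (cancel W _ _ _ W0 ej); ring.
  - by apply: (cancel N _ _ _ N0 ek); ring.
  - by apply/esym/(cancel N _ _ _ N0 ei_u); ring.
  - by apply/esym/(cancel W _ _ _ W0 ek_w); ring.
case: key => half; first exact: kite_bisected klij w0 uw ki half.
(* The diagonals exchange roles, and [s] and [t] with them. *)
apply: (@kite_bisected R q k l i j t s) => //; first by rewrite dotpC.
by rewrite -[LHS]opprB ki opprB.
Qed.
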